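(* Let $(X,d)$ be a metric space with basepoint $e\in X$. For each $n\in\mathbb{N}$, $n\ge1$, the space $\mathrm{SP}^n(X)$ (with its quotient topology) admits a metric $d_n$ inducing its topology such that the canonical inclusion $(\mathrm{SP}^n(X),d_n)\hookrightarrow \mathbb{N}[X]$ is an isometric embedding.
   Context: Let $(X,d)$ be a metric space with distinguished basepoint $e\in X$. For $n\ge 1$, $\mathrm{SP}^n(X)=X^n/S_n$ is the quotient (with the quotient topology) of the product space $X^n$ by the coordinate-permutation action of the symmetric group $S_n$; the orbit of $(x_1,\dots,x_n)$ is written $[x_1,\dots,x_n]$. The map $[x_1,\dots,x_n]\mapsto[x_1,\dots,x_n,e]$ embeds $\mathrm{SP}^n(X)$ in $\mathrm{SP}^{n+1}(X)$, and the set $\mathrm{SP}(X)$ is the union $\bigcup_{n\ge1}\mathrm{SP}^n(X)$ of the increasing sequence so obtained. Thus elements of $\mathrm{SP}(X)$ are finite unordered lists $[x_1,\dots,x_m]$ of points of $X$, with $[x_1,\dots,x_m]=[x_1,\dots,x_m,e]$. Matching distance: for $[x_1,\dots,x_m],[y_1,\dots,y_n]\in \mathrm{SP}(X)$ and $N\ge m+n$ let $\mathbf{x}_N=(x_1,\dots,x_m,e,\dots,e)$ and $\mathbf{y}_N=(y_1,\dots,y_n,e,\dots,e)$ be the lists padded with copies of $e$ to length $N$, and let $\mathbf{x}_N(i)$, $\mathbf{y}_N(i)$ be their $i$-th entries. Then $$d_{\mathbb{N}[X]}([x_1,\dots,x_m],[y_1,\dots,y_n]):=\inf_{N\ge m+n}\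 \min_{\sigma\in S_N}\ \sum_{i=1}^N d\bigl(\mathbf{x}_N(i),\mathbf{y}_N(\sigma(i))\bigr),$$ which is a well-defined metric on the set $\mathrm{SP}(X)$. The metric space $(\mathrm{SP}(X),d_{\mathbb{N}[X]})$ is denoted $\mathbb{N}[X]$. The canonical inclusion $\mathrm{SP}^n(X)\hookrightarrow\mathbb{N}[X]$ is the inclusion of $\mathrm{SP}^n(X)$ in the union $\mathrm{SP}(X)$. *)

(* Defs.v *)
From HB Require Import structures.
From mathcomp Require Import all_fingroup.
From mathcomp Require Import all_boot all_order all_algebra.
From mathcomp Require Import all_classical all_reals all_analysis.

Set Implicit Arguments.
Unset Strict Implicit.
Unset Printing Implicit Defensive.

Import Order.TTheory GRing.Theory Num.Theory.

Local Open Scope classical_set_scope.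
Local Open Scope ring_scope.
Local Open Scope quotient_scope.

Notation power X n := (prod_topology (fun _ : 'I_n => X)).

Section SymmetricProduct.
Variables (X : topologicalType) (n : nat).

Definition same_orbit : rel (power X n) :=
  fun x y => `[< exists s : 'S_n, y = x \o s >].

Lemma same_orbit_refl : reflexive same_orbit.
Proof. by move=> x; apply/asboolP; exists 1%g; apply/funext=> i /=; rewrite perm1. Qed.

Lemma same_orbit_sym : symmetric same_orbit.
Proof.
suff h x y : same_orbit x y -> same_orbit y x by move=> x y; apply/idP/idP; exact: h.
move=> /asboolP[s ->]; apply/asboolP; exists s^-1%g.
by apply/funext=> i /=; rewrite permKV.
Qed.

Lemma same_orbit_trans : transitive same_orbit.
Proof.
move=> y x z /asboolP[s ->] /asboolP[t ->]; apply/asboolP; exists (t * s)%g.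
by apply/funext=> i /=; rewrite permM.
Qed.

Canonical same_orbit_equiv :=
  EquivRel same_orbit same_orbit_refl same_orbit_sym same_orbit_trans.

Definition SP : Type := quotient_topology {eq_quot same_orbit}.

HB.instance Definition _ := Topological.on SP.
HB.instance Definition _ := Quotient.on SP.

Lemma SP_eqP (x y : power X n) :
  \pi_SP x = \pi_SP y <-> exists s : 'S_n, y = x \o s.
Proof.
rewrite -[_ = _]/(\pi_{eq_quot same_orbit} x = \pi_{eq_quot same_orbit} y).
by split=> [/eqquotP/asboolP|h]; last exact/eqquotP/asboolP.
Qed.

End SymmetricProduct.

Section InfiniteSymmetricProduct.
Variables (X : topologicalType) (e : X).

Definition pad (m : nat) (x : power X m) (N : nat) : power X N :=
  fun i => oapp x e (insub (val i)).
Arguments pad {m} x N : simpl never.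

Lemma pad_pad m (x : power X m) M N : (m <= M)%N ->
  pad (pad x M) N = pad x N.
Proof.
move=> mM; apply/funext=> i; rewrite /pad; case: insubP => //= [j _ -> //|iM].
by rewrite insubN// -leqNgt (leq_trans mM)// leqNgt.
Qed.

Lemma pad_id m (x : power X m) : pad x m = x.
Proof. by apply/funext=> i; rewrite /pad valK. Qed.

Lemma pad_out m (x : power X m) N (i : 'I_N) : (m <= i)%N -> pad x N i = e.
Proof. by move=> mi; rewrite /pad insubN// -leqNgt. Qed.

Lemma pad_widen m (x : power X m) N (i : 'I_N) :
  pad x N.+1 (lift ord_max i) = pad x N i.
Proof. by rewrite /pad (_ : val (lift ord_max i) = val i)//; exact: lift_max. Qed.

Lemma pad_perm_leq m m' (x : power X m) (y : power X m') N N' :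
  (m <= N)%N -> (m' <= N)%N -> (N <= N')%N ->
  (exists s : 'S_N, pad y N = pad x N \o s) ->
  exists s : 'S_N', pad y N' = pad x N' \o s.
Proof.
move=> mN m'N; elim: N' => [|K IH].
  by rewrite leqn0 => /eqP ->.
rewrite leq_eqVlt => /predU1P[<- //|]; rewrite ltnS => NK h.
have [s E] := IH NK h; exists (lift_perm ord_max ord_max s).
apply/funext=> i /=; have [j|] := unliftP ord_max i => [|->].
  by move=> ->; rewrite lift_perm_lift !pad_widen E.
by rewrite lift_perm_id !pad_out// (leq_trans _ NK).
Qed.

Definition SPstab (n : nat) (u : SP X n) : SP X n.+1 :=
  \pi_(SP X n.+1) (pad (repr u) n.+1).

Lemma SPstab_pi n (x : power X n) :
  SPstab (\pi_(SP X n) x) = \pi_(SP X n.+1) (pad x n.+1).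
Proof.
apply/esym/SP_eqP; apply: (@pad_perm_leq _ _ _ _ n) => //.
have /SP_eqP [s E] : \pi_(SP X n) x = \pi_(SP X n) (repr (\pi_(SP X n) x)).
  by rewrite reprK.
by exists s; rewrite !pad_id.
Qed.

(* An element of the increasing union is a point of some SP^m, m >= 1 (a
   [stage]); two of them are identified when their images agree in a common
   SP^N. Lemmas [SPincl_surj], [SPincl_inj] and [SPincl_stab] below show that
   [SPinf] is the union of the SP^m. *)
Definition stage : Type := {m : nat & SP X m.+1}.

HB.instance Definition _ := Choice.on stage.

Definition next_stage (u : stage) : stage :=
  Tagged (fun m => SP X m.+1) (SPstab (tagged u)).

Definition same_limit : rel stage :=
  fun u v => `[< exists j k, iter j next_stage u = iter k next_stage v >].

Lemma same_limit_refl : reflexive same_limit.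
Proof. by move=> u; apply/asboolP; exists 0%N, 0%N. Qed.

Lemma same_limit_sym : symmetric same_limit.
Proof.
by move=> u v; apply/asboolP/asboolP => -[j [k E]]; exists k, j.
Qed.

Lemma same_limit_trans : transitive same_limit.
Proof.
move=> v u w /asboolP[j [k E]] /asboolP[j' [k' E']]; apply/asboolP.
exists (j' + j)%N, (k + k')%N.
by rewrite !iterD E -E' -!iterD addnC.
Qed.

Canonical same_limit_equiv :=
  EquivRel same_limit same_limit_refl same_limit_sym same_limit_trans.

Definition SPinf : Type := {eq_quot same_limit}.

HB.instance Definition _ := Choice.on SPinf.
HB.instance Definition _ := Quotient.on SPinf.

Definition SPincl (n : nat) (u : SP X n.+1) : SPinf :=
  \pi_SPinf (Tagged (fun m => SP X m.+1) u).

Lemma SPincl_surj (w : SPinf) :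
  exists m (x : power X m.+1), w = SPincl (\pi_(SP X m.+1) x).
Proof.
exists (tag (repr w)), (repr (tagged (repr w))).
by rewrite /SPincl reprK -[LHS]reprK; case: (repr w).
Qed.

(* the two lists agree up to order and copies of e *)
Definition sim m m' (x : power X m) (y : power X m') :=
  exists N, [/\ (m <= N)%N, (m' <= N)%N & exists s : 'S_N, pad y N = pad x N \o s].

Lemma iter_next_stage m (x : power X m.+1) k :
  iter k next_stage (Tagged (fun m => SP X m.+1) (\pi_(SP X m.+1) x)) =
  Tagged (fun m => SP X m.+1) (\pi_(SP X (k + m).+1) (pad x (k + m).+1)).
Proof.
elim: k => [|k IH] /=; first by rewrite pad_id.
by rewrite IH /next_stage /= SPstab_pi pad_pad// ltnS leq_addl.
Qed.

Lemma Tagged_pi_sim m m' (x : power X m.+1) (y : power X m'.+1) :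
  Tagged (fun m => SP X m.+1) (\pi_(SP X m.+1) x) =
  Tagged (fun m => SP X m.+1) (\pi_(SP X m'.+1) y) -> sim x y.
Proof.
move=> E; have /= Em := congr1 tag E; subst m'; move/eqP: E.
rewrite eq_Tagged /= => /eqP/SP_eqP[s E].
by exists m.+1; split=> //; exists s; rewrite !pad_id.
Qed.

Lemma SPincl_eqP m m' (x : power X m.+1) (y : power X m'.+1) :
  SPincl (\pi_(SP X m.+1) x) = SPincl (\pi_(SP X m'.+1) y) <-> sim x y.
Proof.
rewrite /SPincl; split.
  move=> /eqquotP/asboolP[j [k]]; rewrite !iter_next_stage => /Tagged_pi_sim.
  move=> [N [jN kN]]; rewrite !pad_pad ?ltnS ?leq_addl// => h.
  by exists N; split=> //; [move: jN|move: kN]; apply: leq_trans; rewrite ltnS leq_addl.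
move=> [[|K] [//= mK m'K h]]; rewrite !ltnS in mK m'K.
apply/eqquotP/asboolP; exists (K - m)%N, (K - m')%N.
by rewrite !iter_next_stage !subnK//; congr Tagged; exact/SP_eqP.
Qed.

Lemma sim_same_orbit m (x y : power X m) :
  sim x y -> exists s : 'S_m, y = x \o s.
Proof.
have tupleE k (f : 'I_k -> X) : [tuple f i | i < k] = map f (enum 'I_k) :> seq X.
  by congr map; exact: val_ord_tuple.
have map_pad N (z : power X m) : (m <= N)%N ->
    map (pad z N) (enum 'I_N) = map z (enum 'I_m) ++ nseq (N - m) e.
  elim: N => [|N IH] mN.
    by move: mN z; rewrite leqn0 => /eqP -> z; rewrite cats0 pad_id.
  move: mN; rewrite leq_eqVlt => /predU1P[Em|].
    by subst m; rewrite subnn cats0 pad_id.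
  rewrite ltnS => mN; rewrite enum_ordSr map_rcons -map_comp pad_out//.
  by rewrite subSn// -[(N - m).+1]addn1 nseqD catA cats1 -IH//.
move=> [N [mN _ [s E]]].
have : perm_eq [tuple pad y N i | i < N] [tuple pad x N i | i < N].
  apply/tuple_permP; exists s; congr val; apply: eq_mktuple => i.
  by rewrite tnth_mktuple E.
rewrite (tupleE _ (pad y N)) (tupleE _ (pad x N)) !map_pad// perm_cat2r.
rewrite -(tupleE _ x) -(tupleE _ y) => /tuple_permP[t Et]; exists t.
apply/funext => i; move/val_inj: Et => /(congr1 (fun u => tnth u i)).
by rewrite !tnth_mktuple.
Qed.

Lemma SPincl_inj m : injective (@SPincl m).
Proof.
move=> u v; rewrite -[u]reprK -[v]reprK => /SPincl_eqP /sim_same_orbit h.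
exact/SP_eqP.
Qed.

Lemma SPincl_stab m (u : SP X m.+1) : SPincl (SPstab u) = SPincl u.
Proof. by apply/eqquotP/asboolP; exists 0%N, 1%N. Qed.

End InfiniteSymmetricProduct.

Arguments pad {X} e {m} x N : simpl never.
Arguments sim {X} e {m m'} x y.
Arguments SPincl {X} e {n} u.

Section MatchingDistance.
Context {R : realType} {X : metricType R}.

Definition match_cost N (x y : power X N) (s : 'S_N) : R :=
  \sum_(i < N) mdist (x i) (y (s i)).

(* the default value of the minimum is one of the costs, so it has no effect *)
Definition min_match_cost N (x y : power X N) : R :=
  \big[Num.min/match_cost x y 1%g]_(s : 'S_N) match_cost x y s.

Definition matching_dist (e : X) m n (x : power X m) (y : power X n) : R :=
  inf [set min_match_cost (pad e x N) (pad e y N) | N in [set N | (m + n <= N)%N]].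

Lemma match_cost_ge0 N (x y : power X N) s : 0 <= match_cost x y s.
Proof. by apply: sumr_ge0 => i _; exact: mdist_ge0. Qed.

Lemma min_match_cost_le N (x y : power X N) s : min_match_cost x y <= match_cost x y s.
Proof. exact: bigmin_le_cond. Qed.

Lemma min_match_cost_attained N (x y : power X N) :
  exists s, min_match_cost x y = match_cost x y s.
Proof.
rewrite /min_match_cost.
elim/big_ind: _ => [|_ _ [s ->] [t ->]|s _]; [by exists 1%g| |by exists s].
by rewrite /Order.min; case: ifP => _; [exists s|exists t].
Qed.

Lemma match_cost_perm N (x y : power X N) (a b s : 'S_N) :
  match_cost (x \o a) (y \o b) s = match_cost x y (a^-1 * s * b)%g.
Proof.
rewrite /match_cost [RHS](reindex_inj (@perm_inj _ a)) /=.
by apply: eq_bigr => i _; rewrite !permM permK.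
Qed.

Lemma match_cost_inv N (x y : power X N) s :
  match_cost y x s^-1%g = match_cost x y s.
Proof.
rewrite /match_cost (reindex_inj (@perm_inj _ s)) /=.
by apply: eq_bigr => i _; rewrite permK metric_sym.
Qed.

Lemma match_cost_triangle N (x y z : power X N) s t :
  match_cost x z (s * t)%g <= match_cost x y s + match_cost y z t.
Proof.
rewrite /match_cost [X in _ <= _ + X](reindex_inj (@perm_inj _ s)) /= -big_split /=.
by apply: ler_sum => i _; rewrite permM metric_triangle.
Qed.

Variable e : X.

Lemma match_cost_extend m n (x : power X m) (y : power X n) N N' (s : 'S_N) :
  (m <= N)%N -> (n <= N)%N -> (N <= N')%N ->
  exists s' : 'S_N',
    match_cost (pad e x N') (pad e y N') s' = match_cost (pad e x N) (pad e y N) s.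
Proof.
move=> mN nN; elim: N' => [|K IH].
  by rewrite leqn0 => /eqP E; subst N; exists s.
rewrite leq_eqVlt => /predU1P[E|]; first by subst N; exists s.
rewrite ltnS => NK; have [t Et] := IH NK.
exists (lift_perm ord_max ord_max t); rewrite -Et /match_cost.
rewrite (bigD1_ord ord_max)//= lift_perm_id !pad_out ?(leq_trans _ NK)//.
rewrite mdistxx add0r; apply: eq_bigr => i _.
by rewrite lift_perm_lift !pad_widen.
Qed.

Section Arrays.
Variables (m n : nat) (x : power X m) (y : power X n).

Let costs := [set min_match_cost (pad e x N) (pad e y N) | N in [set N | (m + n <= N)%N]].

Let costs_lb : lbound costs 0.
Proof.
move=> _ [N _ <-].
by have [s ->] := min_match_cost_attained (pad e x N) (pad e y N); exact: match_cost_ge0.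
Qed.

Let costs_inf : has_inf costs.
Proof.
split; last by exists 0.
by exists (min_match_cost (pad e x (m + n)) (pad e y (m + n))), (m + n)%N => /=.
Qed.

Lemma matching_dist_ge0 : 0 <= matching_dist e x y.
Proof. by apply: lb_le_inf => //; case: costs_inf. Qed.

Lemma matching_dist_le N (s : 'S_N) : (m <= N)%N -> (n <= N)%N ->
  matching_dist e x y <= match_cost (pad e x N) (pad e y N) s.
Proof.
move=> mN nN.
have [t <-] := match_cost_extend x y s mN nN (leq_addl (m + n) N).
apply: le_trans (min_match_cost_le _ _ t); apply: ge_inf; first by case: costs_inf.
by exists (m + n + N)%N => //=; rewrite leq_addr.
Qed.

Lemma matching_dist_lt (d : R) : 0 < d -> exists N, [/\ (m <= N)%N, (n <= N)%N &
  exists s : 'S_N, match_cost (pad e x N) (pad e y N) s < matching_dist e x y + d].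
Proof.
move=> d0; have [_ [N /= mnN <-] H] := inf_adherent d0 costs_inf.
exists N; split; [exact: leq_trans (leq_addr _ _) mnN|
  exact: leq_trans (leq_addl _ _) mnN|].
by have [s Es] := min_match_cost_attained (pad e x N) (pad e y N); exists s; rewrite -Es.
Qed.

Lemma matching_dist_eq0 : matching_dist e x y = 0 -> sim e x y.
Proof.
move=> E0.
pose dd (p : option 'I_m * option 'I_n) := mdist (oapp x e p.1) (oapp y e p.2).
pose d := \big[Num.min/1]_(p | 0 < dd p) dd p.
have d0 : 0 < d by apply: lt_bigmin.
have [N [mN nN [s]]] := matching_dist_lt d0; rewrite E0 add0r => H.
exists N; split=> //; exists s^-1%g; apply/funext => j /=.
rewrite -[j in LHS](permKV s); move: (s^-1 j)%g => i.
apply/esym/mdist_positivity/eqP; move: H; apply: contraTT => di.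
rewrite -leNgt /match_cost (bigD1 i)//=.
have Ed : mdist (pad e x N i) (pad e y N (s i)) = dd (insub (val i), insub (val (s i))).
  by [].
rewrite -[leLHS]addr0 lerD ?sumr_ge0// => [|*]; last exact: mdist_ge0.
by rewrite Ed; apply: bigmin_le_cond; rewrite -Ed lt_def di mdist_ge0.
Qed.

End Arrays.

Lemma matching_dist_sim m m' n n' (x : power X m) (x' : power X m')
    (y : power X n) (y' : power X n') :
  sim e x x' -> sim e y y' -> matching_dist e x' y' = matching_dist e x y.
Proof.
move=> [A [mA m'A hA]] [B [nB n'B hB]]; apply/eqP; rewrite eq_le; apply/andP; split;
  apply/ler_addgt0Pl => d d0; rewrite addrC.
- have [N [mN nN [s /ltW]]] := matching_dist_lt x y d0; apply: le_trans.
  pose K := (N + A + B)%N.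
  have NK : (N <= K)%N by rewrite /K -addnA leq_addr.
  have AK : (A <= K)%N by rewrite /K addnAC leq_addl.
  have BK : (B <= K)%N by rewrite /K leq_addl.
  have [a Ea] := pad_perm_leq mA m'A AK hA.
  have [b Eb] := pad_perm_leq nB n'B BK hB.
  have [t <-] := match_cost_extend x y s mN nN NK.
  have -> : t = (a^-1 * (a * t * b^-1) * b)%g by rewrite !mulgA mulVg mul1g mulgKV.
  rewrite -match_cost_perm -Ea -Eb; apply: matching_dist_le.
    exact: leq_trans AK.
  exact: leq_trans BK.
- have [N [mN nN [s /ltW]]] := matching_dist_lt x' y' d0; apply: le_trans.
  pose K := (N + A + B)%N.
  have NK : (N <= K)%N by rewrite /K -addnA leq_addr.
  have AK : (A <= K)%N by rewrite /K addnAC leq_addl.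
  have BK : (B <= K)%N by rewrite /K leq_addl.
  have [a Ea] := pad_perm_leq mA m'A AK hA.
  have [b Eb] := pad_perm_leq nB n'B BK hB.
  have [t <-] := match_cost_extend x' y' s mN nN NK.
  rewrite Ea Eb match_cost_perm; apply: matching_dist_le.
    exact: leq_trans AK.
  exact: leq_trans BK.
Qed.

(* [SPinf_distE] shows independence of the chosen representatives *)
Definition SPinf_dist (u v : SPinf e) : R :=
  matching_dist e (repr (tagged (repr u))) (repr (tagged (repr v))).

Lemma SPinf_distE m n (x : power X m.+1) (y : power X n.+1) :
  SPinf_dist (SPincl e (\pi_(SP X m.+1) x)) (SPincl e (\pi_(SP X n.+1) y)) =
  matching_dist e x y.
Proof.
have h k (z : power X k.+1) :
    sim e z (repr (tagged (repr (SPincl e (\pi_(SP X k.+1) z))))).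
  apply/SPincl_eqP; rewrite reprK [RHS]/SPincl.
  by set w := SPincl e _; rewrite -[LHS]reprK; case: (repr w).
exact: matching_dist_sim.
Qed.

Lemma SPinf_distxx u : SPinf_dist u u = 0.
Proof.
have [m [x ->]] := SPincl_surj u; rewrite SPinf_distE.
apply/eqP; rewrite eq_le matching_dist_ge0 andbT.
apply: le_trans (matching_dist_le x x 1%g (leqnn _) (leqnn _)) _.
by rewrite /match_cost big1// => i _; rewrite perm1 mdistxx.
Qed.

Lemma SPinf_dist_positivity u v : SPinf_dist u v = 0 -> u = v.
Proof.
have [m [x ->]] := SPincl_surj u; have [n [y ->]] := SPincl_surj v.
by rewrite SPinf_distE => /matching_dist_eq0 /SPincl_eqP.
Qed.

Lemma SPinf_dist_sym u v : SPinf_dist u v = SPinf_dist v u.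
Proof.
have [m [x ->]] := SPincl_surj u; have [n [y ->]] := SPincl_surj v.
rewrite !SPinf_distE.
suff h k l (a : power X k) (b : power X l) :
  matching_dist e a b <= matching_dist e b a by apply/eqP; rewrite eq_le !h.
apply/ler_addgt0Pl => d d0; rewrite addrC.
have [N [lN kN [s /ltW]]] := matching_dist_lt b a d0; apply: le_trans.
by rewrite -match_cost_inv; exact: matching_dist_le.
Qed.

Lemma SPinf_dist_triangle v u w :
  SPinf_dist u w <= SPinf_dist u v + SPinf_dist v w.
Proof.
have [m [x ->]] := SPincl_surj u; have [n [y ->]] := SPincl_surj v.
have [p [z ->]] := SPincl_surj w; rewrite !SPinf_distE.
apply/ler_addgt0Pl => d d0; rewrite addrC.
have d2 : 0 < d / 2 by rewrite divr_gt0.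
have [N [mN nN [s Hs]]] := matching_dist_lt x y d2.
have [M [nM pM [t Ht]]] := matching_dist_lt y z d2.
have [s' Es] := match_cost_extend x y s mN nN (leq_addr M N).
have [t' Et] := match_cost_extend y z t nM pM (leq_addl N M).
apply: (@le_trans _ _ (match_cost (pad e x (N + M)) (pad e z (N + M)) (s' * t')%g)).
  by apply: matching_dist_le; [exact: leq_trans (leq_addr _ _)|exact: leq_trans (leq_addl _ _)].
apply: le_trans (match_cost_triangle _ (pad e y (N + M)) _ _ _) _.
rewrite Es Et [d in leRHS]splitr addrACA; apply: lerD; exact: ltW.
Qed.

Definition NX : Type := SPinf e.

HB.instance Definition _ := Choice.on NX.
HB.instance Definition _ := @isMetric.Build R NX SPinf_dist
  SPinf_distxx SPinf_dist_positivity SPinf_dist_sym SPinf_dist_triangle.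

End MatchingDistance.

Definition is_metric (R : realType) (T : Type) (d : T -> T -> R) : Prop :=
  [/\ forall u v, 0 <= d u v,
      forall u v, d u v = 0 <-> u = v,
      forall u v, d u v = d v u &
      forall u v w, d u w <= d u v + d v w].

Definition metric_induces_topology (R : realType) (T : topologicalType)
    (d : T -> T -> R) : Prop :=
  forall U : set T, open U <->
    forall u, U u -> exists2 r : R, 0 < r & [set v | d u v < r] `<=` U.

(* Main.v *)
Require Import Defs.
From mathcomp Require Import all_fingroup.
From mathcomp Require Import all_boot all_order all_algebra.
From mathcomp Require Import all_classical all_reals all_analysis.

Set Implicit Arguments.
Unset Strict Implicit.
Unset Printing Implicit Defensive.

Import Order.TTheory GRing.Theory Num.Theory.

Local Open Scope classical_set_scope.
Local Open Scope ring_scope.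
Local Open Scope quotient_scope.

(** The metric on SP^n(X) can only be the restriction of the matching distance,
    and since the inclusion of SP^n(X) in SP(X) is injective this is a metric.
    What has to be shown is that it induces the quotient topology.

    The point is that padding with copies of e never makes matching cheaper.
    If two lists both end in e, a matching of them can avoid these two entries:
    when it pairs x_a with the last e of one list and the last e of the other
    with y_b, pair x_a with y_b instead, which costs at most
    d(x_a, e) + d(e, y_b) by the triangle inequality ([match_cost_drop_max]).
    Removing the padding one entry at a time shows that, for lists of the same
    length n, the matching distance is the minimum over S_n alone of the sums
    of the d(x_i, y_s(i)) ([matching_distE]), with no e involved.

    With this formula both inclusions of topologies are immediate, as the
    neighbourhoods in X^n are given by boxes ([nbhs_boxP]). If [y] is within r
    of [x], then after permuting y every y_i is within r of x_i; so
    an open set whose preimage contains the box of radius r around x contains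
    the ball of radius r around [x]. Conversely, if every y_i is within r / n
    of x_i, the identity matching shows that [y] is within r of [x]. *)

(** * Matchings of lists of equal length *)

Section Matchings.
Context {R : realType} {X : metricType R}.

Lemma perm_fixing_max K (s : 'S_K.+1) :
  s ord_max = ord_max -> exists t : 'S_K, s = lift_perm ord_max ord_max t.
Proof.
move=> sm.
have liftE i : exists j, s (lift ord_max i) = lift ord_max j.
  have [j ->|E] := unliftP ord_max (s (lift ord_max i)); first by exists j.
  by have /eqP := neq_lift ord_max i; case; apply: (@perm_inj _ s); rewrite sm E.
have [f fE] := choice liftE.
have f_inj : injective f.
  by move=> i j ij; apply: (@lift_inj _ ord_max); apply: (@perm_inj _ s); rewrite !fE ij.
exists (perm f_inj); apply/perm.permP => i; have [j ->|->] := unliftP ord_max i.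
  by rewrite lift_perm_lift permE fE.
by rewrite lift_perm_id.
Qed.

(** Composing s with the transposition of s(max) and max makes the last entries
    match each other, for free, and reroutes the entry a that was sent to max
    directly to s(max). The triangle inequality through the common last entry
    pays for the new pair. *)
Lemma match_cost_drop_max K (z w : power X K.+1) (s : 'S_K.+1) :
  z ord_max = w ord_max ->
  exists t : 'S_K,
    match_cost (z \o lift ord_max) (w \o lift ord_max) t <= match_cost z w s.
Proof.
move=> zw; pose u := (s * tperm (s ord_max) ord_max)%g.
have [t ut] : exists t, u = lift_perm ord_max ord_max t.
  by apply: perm_fixing_max; rewrite permM tpermL.
exists t.
have -> : match_cost (z \o lift ord_max) (w \o lift ord_max) t = match_cost z w u.
  rewrite [RHS](bigD1_ord ord_max)//= ut lift_perm_id zw mdistxx add0r.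
  by apply: eq_bigr => i _; rewrite lift_perm_lift.
(* u is s if s fixes max; otherwise they differ only at max and a = s^-1(max) *)
have [sm|sm] := eqVneq (s ord_max) ord_max.
  by rewrite /u sm tperm1 mulg1.
pose a := (s^-1 ord_max)%g.
have sa : s a = ord_max by rewrite permKV.
have am : a != ord_max by apply: contra_neq sm => aE; rewrite -{1}aE sa.
rewrite /match_cost (bigD1 ord_max)//= (bigD1 a)//=.
rewrite [leRHS](bigD1 ord_max)//= [X in _ <= _ + X](bigD1 a)//=.
rewrite !permM sa tpermL tpermR zw mdistxx add0r addrA lerD//.
  by rewrite addrC metric_triangle.
rewrite le_eqVlt; apply/orP; left; apply/eqP; apply: eq_bigr => i /andP[im ia].
rewrite permM tpermD//.
  by rewrite eq_sym (inj_eq perm_inj).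
by rewrite -sa eq_sym (inj_eq perm_inj).
Qed.

Variable e : X.

(** Both padded lists end in e as long as N exceeds m, so the padding can be
    dropped entry by entry down to length m. *)
Lemma match_cost_unpad m (x y : power X m) N (s : 'S_N) : (m <= N)%N ->
  exists t : 'S_m, match_cost x y t <= match_cost (pad e x N) (pad e y N) s.
Proof.
elim: N s => [|N IH] s.
  by rewrite leqn0 => /eqP m0; subst m; exists s; rewrite !pad_id.
rewrite leq_eqVlt => /predU1P[mE|]; first by subst m; exists s; rewrite !pad_id.
rewrite ltnS => mN.
have [|t tle] := @match_cost_drop_max _ (pad e x N.+1) (pad e y N.+1) s.
  by rewrite !pad_out.
have [t' t'le] := IH t mN; exists t'; apply: le_trans t'le _.
have dropE (v : power X m) : pad e v N.+1 \o lift ord_max = pad e v N.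
  by apply/funext => i /=; rewrite pad_widen.
by rewrite -!dropE.
Qed.

(** The infimum runs over padded lengths N >= 2 m; extending a matching by
    pairs (e, e) and unpadding it give the two inequalities with N = m. *)
Lemma matching_distE m (x y : power X m) :
  matching_dist e x y = min_match_cost x y.
Proof.
apply/eqP; rewrite eq_le; apply/andP; split.
  have [s ->] := min_match_cost_attained x y.
  have := matching_dist_le e x y s (leqnn m) (leqnn m).
  by rewrite !pad_id.
apply/ler_addgt0Pl => d d0; rewrite addrC.
have [N [mN _ [s /ltW]]] := matching_dist_lt e x y d0; apply: le_trans.
have [t] := match_cost_unpad x y s mN; apply: le_trans.
exact: min_match_cost_le.
Qed.

End Matchings.

(** * Neighbourhoods in a finite power of a metric space *)

Section Topology.
Context {R : realType} {X : metricType R}.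

Definition box n (x : power X n) (r : R) : set (power X n) :=
  [set y | forall i, mdist (x i) (y i) < r].

(** Finiteness of the index set is what makes a box a neighbourhood. In the other
    direction, the filter generated by the boxes converges to x because each of
    its projections does. *)
Lemma nbhs_boxP n (x : power X n) (A : set (power X n)) :
  nbhs x A <-> exists2 r : R, 0 < r & box x r `<=` A.
Proof.
split; last first.
  move=> [r r0 rA]; apply: filterS rA _.
  have near_i i : nbhs x [set y : power X n | mdist (x i) (y i) < r].
    have : nbhs (x i) [set z | mdist (x i) z < r].
      by rewrite -ballEmdist; exact: nbhsx_ballx.
    exact: (@proj_continuous _ (fun=> X) i x).
  exact: filter_forall near_i.
pose F := filter_from [set r : R | 0 < r] (box x).
suff : F --> x by move=> /[apply] -[r r0 rA]; exists r.
have FF : Filter F.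
  apply: filter_from_filter; first by exists 1; rewrite /= ltr01.
  move=> r s r0 s0; exists (Num.min r s); first by rewrite /= lt_min r0.
  by move=> y yrs; split=> i; have := yrs i; rewrite lt_min => /andP[].
apply/cvg_sup => i B; rewrite nbhsE => -[_ [[C oC <-] Cx] CB].
have /nbhs_ballP[r /= r0 rC] : nbhs (x i) C by exact: open_nbhs_nbhs.
exists r => // y yr; apply: CB; apply: rC; rewrite ballEmdist; exact: yr.
Qed.

End Topology.

(** * The restricted matching distance on SP^n(X) *)

Section SPmetric.
Context {R : realType} {X : metricType R}.
Variables (e : X) (n : nat).

Definition SPdist (u v : SP X n.+1) : R :=
  mdist (SPincl e u : NX e) (SPincl e v : NX e).

Lemma SPdist_pi (x y : power X n.+1) :
  SPdist (\pi_(SP X n.+1) x) (\pi_(SP X n.+1) y) = min_match_cost x y.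
Proof. by rewrite -(matching_distE e) -SPinf_distE. Qed.

Lemma SPdist_is_metric : is_metric SPdist.
Proof.
split=> [u v|u v|u v|u v w].
- exact: mdist_ge0.
- split=> [/mdist_positivity/SPincl_inj //|->]; exact: mdistxx.
- exact: metric_sym.
- exact: metric_triangle.
Qed.

Lemma SPdist_induces_topology : metric_induces_topology SPdist.
Proof.
move=> U; split=> [oU u Uu | Uball].
  have [x xu] : exists x, \pi_(SP X n.+1) x = u by exists (repr u); rewrite reprK.
  have : nbhs x (\pi_(SP X n.+1) @^-1` U).
    by apply: open_nbhs_nbhs; split; [exact: oU|rewrite /= xu].
  move=> /nbhs_boxP[r r0 rU]; exists r => // v.
  have [y <-] : exists y, \pi_(SP X n.+1) y = v by exists (repr v); rewrite reprK.
  rewrite /= -xu SPdist_pi; have [s ->] := min_match_cost_attained x y => sr.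
  (* reordered along an optimal matching, y lies in the box around x *)
  have -> : \pi_(SP X n.+1) y = \pi_(SP X n.+1) (y \o s) by apply/SP_eqP; exists s.
  apply: rU => i; apply: le_lt_trans sr.
  rewrite /match_cost (bigD1 i)//= lerDl sumr_ge0// => j _; exact: mdist_ge0.
(* a set is open in the quotient exactly when its preimage is open, by definition *)
rewrite -[open U]/(open (\pi_(SP X n.+1) @^-1` U)) openE => x /Uball[r r0 rU].
apply/nbhs_boxP; exists (r / n.+1%:R); first by rewrite divr_gt0.
move=> y xy; apply: rU; rewrite /= SPdist_pi.
apply: le_lt_trans (min_match_cost_le _ _ 1%g) _; rewrite /match_cost.
have -> : r = \sum_(i < n.+1) r / n.+1%:R.
  by rewrite sumr_const card_ord -[RHS]mulr_natr divfK.
apply: ltr_sum => [|i _]; first by apply/hasP; exists ord0; rewrite ?mem_index_enum.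
by rewrite perm1; exact: xy.
Qed.

End SPmetric.

(* the index n.+1 ranges over the integers >= 1 *)
Theorem theorem3p5 (R : realType) (X : metricType R) (e : X) (n : nat) :
  exists d : SP X n.+1 -> SP X n.+1 -> R,
    [/\ is_metric d,
        metric_induces_topology d &
        forall u v : SP X n.+1,
          mdist (SPincl e u : NX e) (SPincl e v : NX e) = d u v].
Proof.
exists (SPdist e (n := n)); split=> //.
  exact: SPdist_is_metric.
exact: SPdist_induces_topology.
Qed.
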